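(* Let $k$ be an algebraically closed field of characteristic $0$, let $f,g\in k[x,y]$ be non-constant polynomials and let $P\in\mathbb{A}^2(k)$ be a point. Then $$\mathcal{B}_P(f,g) = I_P(f,g),$$ where $\mathcal{B}_P(f,g)$ is the number computed from the infinitely near points at $P$ common to the curves defined by $f$ and $g$, and $I_P(f,g)$ is Fulton's intersection number of these curves at $P$.
   Context: Throughout, $k$ is an algebraically closed field of characteristic $0$. **Curves.** A plane curve $C_f$ in $\mathbb{A}^2=\mathbb{A}^2(k)$ is given by a non-constant polynomial $f\in k[x,y]$, up to a non-zero scalar (so multiplicities of components are retained). $V(f)$ is the set of zeros of $f$ in $k^2$. Two curves $C_f,C_g$ share a component passing through $P$ if $f$ and $g$ have a common non-constant factor vanishing at $P$. For $P=(p_1,p_2)$, the multiplicity $m_P(f)$ is the degree of the lowest-degree non-zero term in the expansion of $f$ as a polynomial in $x-p_1,\,y-p_2$ (so $m_P(f)=0$ iff $P\notin V(f)$). The tangent lines of $C_f$ at $P$ are the lines given by the linear factors of the lowest-degree form of this expansion. For an affine change of coordinates $\varphi:\mathbb{A}^2\to\mathbb{A}^2$ put $f^\varphi=f\circ\varphi^{-1}$. **Blowup.** The blowup of $\mathbb{A}^2$ at $P=(p_1,p_2)$ is the surface $X=V((x-p_1)t_1-(y-p_2)t_0)\subset\mathbb{A}^2\times\mathbb{P}^1$ with projection $\pi:X\to\mathbb{A}^2$. The exceptional line is $\pi^{-1}(P)$. The strict transform $C_f'$ of $C_f$ is the curve on $X$ defined by the saturation ideal $(f\circ\pi):(x-p_1,y-p_2)^\infty$.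 In an affine chart of $X$ isomorphic to $\mathbb{A}^2$ the strict transform is given by a single polynomial, denoted $f'$. Explicitly, with $m=m_P(f)$: - in the chart $t_0\neq0$ with coordinates $(x,z)$, $z=t_1/t_0$, one has $f'(x,z)=(x-p_1)^{-m}f(x,\,p_2+(x-p_1)z)$ and the exceptional line is $x=p_1$; - in the chart $t_1\neq 0$ with coordinates $(w,y)$, $w=t_0/t_1$, one has $f'(w,y)=(y-p_2)^{-m}f(p_1+(y-p_2)w,\,y)$ and the exceptional line is $y=p_2$. The first order infinitely near points of $C_f$ at $P$ are the points where $C_f'$ meets the exceptional line. **The number $\mathcal{B}_P$.** It is defined recursively by $$\mathcal{B}_P(f,g)=\begin{cases}\infty & \text{if } C_f \text{ and } C_g \text{ share a component passing through } P,\\ 0 & \text{if } P\notin V(f)\cap V(g),\\ m_P(f)m_P(g)+\sum_Q \mathcal{B}_Q(f',g') & \text{otherwise,}\end{cases}$$ where $f',g'$ define the strict transforms of $C_f,C_g$ under the blowup at $P$, and $Q$ runs through all first order infinitely near points at $P$ common to $C_f$ and $C_g$. The number $\mathcal{B}_Q(f',g')$ is computed in an affine chart of $X$ containing $Q$, for definiteness the chart $t_0\ne0$ if $Q$ lies in it and the chart $t_1\neq0$ otherwise. The recursion is unfolded as a sum, with values in $\mathbb{N}\cup\{\infty\}$, over successive blowups. **The number $I_P$.** $I_P(f,g)$ is Fulton's intersection number: the unique number defined for all plane curves $C_f,C_g$ and all points $P\in\mathbb{A}^2(k)$ satisfying the following properties (existence and uniqueness are Fulton's theorem): 1. If $C_f,C_g$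 have no common component passing through $P$, then $I_P(f,g)$ is a non-negative integer; otherwise $I_P(f,g)=\infty$. 2. $I_P(f,g)=0$ if and only if $P\notin V(f)$ or $P\notin V(g)$. 3. If $\varphi$ is an affine change of coordinates, then $I_P(f,g)=I_{\varphi(P)}(f^\varphi,g^\varphi)$. 4. $I_P(f,g)=I_P(g,f)$. 5. $I_P(f,g)\ge m_P(f)m_P(g)$, with equality if and only if $C_f$ and $C_g$ have no common tangent line at $P$. 6. $I_P(f_1f_2,g)=I_P(f_1,g)+I_P(f_2,g)$ for any $f_1,f_2\in k[x,y]$. 7. $I_P(f,g)=I_P(f,g+hf)$ for any $h\in k[x,y]$. *)

(* Defs.v *)
From HB Require Import structures.
From mathcomp Require Import all_boot all_order all_algebra finmap.
From mathcomp Require Import boolp classical_sets cardinality fsbigop.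
From mathcomp Require Import mpoly.

Set Implicit Arguments.
Unset Strict Implicit.
Unset Printing Implicit Defensive.

Import GRing.Theory.
Local Open Scope ring_scope.

(* The values of both numbers lie in N with infinity added; None is infinity. *)
Definition enat : Type := option nat.

Definition eadd (a b : enat) : enat :=
  if a is Some m then if b is Some n then Some (m + n)%N else None else None.

Definition ele (a b : enat) : bool :=
  if b is Some n then if a is Some m then (m <= n)%N else false else true.

Lemma eaddA : associative eadd.
Proof. by case=> [a|] [b|] [c|] //=; rewrite addnA. Qed.

Lemma eaddC : commutative eadd.
Proof. by case=> [a|] [b|] //=; rewrite addnC. Qed.

Lemma eadd0 : left_id (Some 0%N) eadd.
Proof. by case=> [a|]. Qed.

HB.instance Definition _ :=
  Monoid.isComLaw.Build enat (Some 0%N) eadd eaddA eaddC eadd0.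

Definition esup (u : nat -> enat) : enat :=
  match pselect (exists b, `[< forall n, ele (u n) (Some b) >]) with
  | left ex_ub => Some (ex_minn ex_ub)
  | right _ => None
  end.

Lemma esup_ub (u : nat -> enat) n : ele (u n) (esup u).
Proof.
rewrite /esup; case: pselect => // ex_ub.
by case: ex_minnP => b /asboolP ub _; exact: ub.
Qed.

Lemma esup_le (u : nat -> enat) b : (forall n, ele (u n) b) -> ele (esup u) b.
Proof.
case: b => [b|] // ub; rewrite /esup; case: pselect => [ex_ub|[]].
- by case: ex_minnP => c _ min_c; apply: min_c; apply/asboolP.
- by exists b; apply/asboolP.
Qed.

Section PlaneCurves.
Variable k : fieldType.

(* The affine plane is 'rV[k]_2; the coordinates of P are P 0 0 and P 0 1, and
   x, y are 'X_0, 'X_1. *)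
Implicit Types (f g h : {mpoly k[2]}) (P : 'rV[k]_2).

Definition pt (a b : k) : 'rV[k]_2 := \row_i tnth [tuple a; b] i.

Definition nonconstant f : bool := (1 < msize f)%N.

Definition on_curve f P : bool := f.@[P 0] == 0.

Definition mdvd h f : Prop := exists q, f = q * h.

Definition share_component P f g : Prop :=
  exists h, [/\ nonconstant h, on_curve h P, mdvd h f & mdvd h g].

(* f(p1 + x, p2 + y), i.e. the expansion of f in powers of x - p1, y - p2. *)
Definition expand P f : {mpoly k[2]} :=
  f \mPo [tuple 'X_i + (P 0 i)%:MP | i < 2].

(* msize is one more than the largest degree of a monomial, so for f != 0 the
   initial value does not affect the minimum. *)
Definition mult P f : nat :=
  let F := expand P f in \big[minn/msize F]_(m <- msupp F) mdeg m.

Definition lowest_form P f : {mpoly k[2]} :=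
  pihomog mdeg (mult P f) (expand P f).

(* (a, b) stands for the line a (x - p1) + b (y - p2) = 0 through P. *)
Definition tangent P f (a b : k) : Prop :=
  (a, b) != (0, 0) /\ mdvd (a *: 'X_0 + b *: 'X_1) (lowest_form P f).

Definition common_tangent P f g : Prop :=
  exists a b, tangent P f a b /\ tangent P g a b.

(* The quotient of f by h in the integral domain k[x, y], when h divides f. *)
Definition mquot f h : {mpoly k[2]} := xget 0 [set q | q * h = f]%classic.

(* Points of the exceptional line are coded by option k: Some z is
   (t0 : t1) = (1 : z), taken in the chart t0 != 0, and None is (0 : 1), taken
   in the chart t1 != 0.  The coordinates of the charts, (x, z) and (w, y), are
   both written ('X_0, 'X_1). *)
Definition strict_transform P (d : option k) f : {mpoly k[2]} :=
  match d with
  | Some _ =>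
      let u := 'X_0 - (P 0 0)%:MP in
      mquot (f \mPo [tuple 'X_0; (P 0 1)%:MP + u * 'X_1]) (u ^+ mult P f)
  | None =>
      let v := 'X_1 - (P 0 1)%:MP in
      mquot (f \mPo [tuple (P 0 0)%:MP + v * 'X_0; 'X_1]) (v ^+ mult P f)
  end.

Definition exc_point P (d : option k) : 'rV[k]_2 :=
  if d is Some z then pt (P 0 0) z else pt 0 (P 0 1).

Definition inf_near P f (d : option k) : bool :=
  on_curve (strict_transform P d f) (exc_point P d).

(* The recursion for B_P(f, g) unfolded n times: only the first n successive
   blowups contribute. *)
Fixpoint B_upto (n : nat) P f g : enat :=
  if n is n'.+1 then
    if `[< share_component P f g >] then None
    else if ~~ (on_curve f P && on_curve g P) then Some 0%N
    else eadd (Some (mult P f * mult P g)%N)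
      (\big[eadd/Some 0%N]_(d \in [set d | inf_near P f d && inf_near P g d]%classic)
         B_upto n' (exc_point P d) (strict_transform P d f)
                                   (strict_transform P d g))
  else Some 0%N.

Definition B_number P f g : enat := esup (fun n => B_upto n P f g).

Definition affine_map (A : 'M[k]_2) (b : 'rV[k]_2) P : 'rV[k]_2 := P *m A + b.

Definition affine_comp f (A : 'M[k]_2) (b : 'rV[k]_2) : {mpoly k[2]} :=
  f \mPo [tuple \sum_j A j i *: 'X_j + (b 0 i)%:MP | i < 2].

(* The inverse of v |-> v A + b is v |-> v A^-1 - b A^-1. *)
Definition affine_change (A : 'M[k]_2) (b : 'rV[k]_2) f : {mpoly k[2]} :=
  affine_comp f (invmx A) (- (b *m invmx A)).

(* Fulton's characterization.  I P f g is only constrained on curves, i.e. for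
   non-constant f and g; fulton_scale says that it depends only on the curves,
   a polynomial being determined by its curve up to a non-zero scalar (it is
   what the additivity property gives when one of the factors is constant). *)
Record fulton_number
    (I : 'rV[k]_2 -> {mpoly k[2]} -> {mpoly k[2]} -> enat) : Prop := {
  fulton_scale : forall P f g (c : k), nonconstant f -> nonconstant g ->
    c != 0 -> I P (c *: f) g = I P f g;
  fulton_finite : forall P f g, nonconstant f -> nonconstant g ->
    ~ share_component P f g -> exists n, I P f g = Some n;
  fulton_infinite : forall P f g, nonconstant f -> nonconstant g ->
    share_component P f g -> I P f g = None;
  fulton_eq0 : forall P f g, nonconstant f -> nonconstant g ->
    I P f g = Some 0%N <-> ~~ on_curve f P \/ ~~ on_curve g P;
  fulton_affine : forall P f g (A : 'M[k]_2) (b : 'rV[k]_2),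
    nonconstant f -> nonconstant g -> A \in unitmx ->
    I P f g = I (affine_map A b P) (affine_change A b f) (affine_change A b g);
  fulton_sym : forall P f g, nonconstant f -> nonconstant g ->
    I P f g = I P g f;
  fulton_ge_mult : forall P f g, nonconstant f -> nonconstant g ->
    ele (Some (mult P f * mult P g)%N) (I P f g);
  fulton_eq_mult : forall P f g, nonconstant f -> nonconstant g ->
    I P f g = Some (mult P f * mult P g)%N <-> ~ common_tangent P f g;
  fulton_mul : forall P f1 f2 g,
    nonconstant f1 -> nonconstant f2 -> nonconstant g ->
    I P (f1 * f2) g = eadd (I P f1 g) (I P f2 g);
  fulton_add : forall P f g h,
    nonconstant f -> nonconstant g -> nonconstant (g + h * f) ->
    I P f g = I P f (g + h * f)
}.

End PlaneCurves.

Section EnatTheory.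
Implicit Types (a b c : enat) (u v : nat -> enat).

Lemma ele_trans b a c : ele a b -> ele b c -> ele a c.
Proof. by case: a b c => [a|] [b|] [c|] //=; apply: leq_trans. Qed.

Lemma ele_refl a : ele a a.
Proof. by case: a => /=. Qed.

Lemma ele_anti a b : ele a b -> ele b a -> a = b.
Proof.
case: a b => [a|] [b|] //= ab ba.
by congr Some; apply/eqP; rewrite eqn_leq ab ba.
Qed.

Lemma ele_add a b c (d : enat) : ele a b -> ele c d -> ele (eadd a c) (eadd b d).
Proof. by case: a b c d => [a|] [b|] [c|] [d|] //=; apply: leq_add. Qed.

Lemma ele_addl a b : ele a (eadd a b).
Proof. by case: a b => [a|] [b|] //=; apply: leq_addr. Qed.

Lemma esup_att u (b : nat) : esup u = Some b -> exists n, u n = Some b.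
Proof.
move=> E; apply: contrapT => no.
have ub n : ele (u n) (Some b) by rewrite -E; exact: esup_ub.
case: b E ub no => [|b] E ub no.
  by apply: no; exists 0%N; case: (u 0%N) (ub 0%N) => // m /=; rewrite leqn0 => /eqP->.
have : ele (esup u) (Some b).
  apply: esup_le => n; move: (ub n) (no); case un: (u n) => [m|] //= mb no'.
  move: mb; rewrite leq_eqVlt => /predU1P[e|//]; case: no'.
  by exists n; rewrite un e.
by rewrite E /= ltnn.
Qed.

Definition nondecr (u : nat -> enat) := forall n p, (n <= p)%N -> ele (u n) (u p).

Lemma esupD u v : nondecr u -> nondecr v ->
  esup (fun n => eadd (u n) (v n)) = eadd (esup u) (esup v).
Proof.
move=> mu mv; apply: ele_anti.
  by apply: esup_le => n; apply: ele_add; exact: esup_ub.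
set s := esup (fun n => eadd (u n) (v n)).
have ub n : ele (eadd (u n) (v n)) s := esup_ub (fun n => eadd (u n) (v n)) n.
case: s ub => [b|] ub; last by case: (eadd _ _).
have : ele (esup u) (Some b).
  by apply: esup_le => n; apply: ele_trans (ub n); exact: ele_addl.
have : ele (esup v) (Some b).
  by apply: esup_le => n; apply: ele_trans (ub n); rewrite eaddC; exact: ele_addl.
case vE: (esup v) => [d|] //; case uE: (esup u) => [c|] // _ _.
have [n un] := esup_att uE; have [p vp] := esup_att vE.
apply: ele_trans (ub (maxn n p)); rewrite -un -vp.
by apply: ele_add; [apply: mu; apply: leq_maxl|apply: mv; apply: leq_maxr].
Qed.

Lemma esupC a : esup (fun=> a) = a.
Proof. by apply: ele_anti; [apply: esup_le => _; exact: ele_refl|exact: (esup_ub (fun=> a) 0%N)]. Qed.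

Lemma mono_sum (T : Type) (r : seq T) (v : T -> nat -> enat) :
  (forall d, nondecr (v d)) ->
  nondecr (fun n => \big[eadd/Some 0%N]_(d <- r) v d n).
Proof.
move=> mv n p np; elim: r => [|d r IH]; first by rewrite !big_nil.
by rewrite !big_cons; apply: ele_add => //; apply: mv.
Qed.

Lemma esup_sum (T : Type) (r : seq T) (v : T -> nat -> enat) :
  (forall d, nondecr (v d)) ->
  esup (fun n => \big[eadd/Some 0%N]_(d <- r) v d n) =
  \big[eadd/Some 0%N]_(d <- r) esup (v d).
Proof.
move=> mv; elim: r => [|d r IH].
  by rewrite big_nil -[RHS]esupC; congr esup; apply: funext => n; rewrite big_nil.
rewrite big_cons -IH -esupD //; last exact: mono_sum.
by congr esup; apply: funext => n; rewrite big_cons.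
Qed.

End EnatTheory.

Section PlaneCurvesTheory.
Variable k : fieldType.
Implicit Types (f g h : {mpoly k[2]}) (P : 'rV[k]_2).

Lemma affine_changeE (A : 'M[k]_2) (b : 'rV[k]_2) f P :
  A \in unitmx -> (affine_change A b f).@[affine_map A b P 0] = f.@[P 0].
Proof.
move=> uA; rewrite comp_mpoly_meval; apply: meval_eq => i.
rewrite tnth_mktuple mevalD mevalC raddf_sum /=.
transitivity (((P *m A + b) *m invmx A - b *m invmx A) 0 i).
  rewrite !mxE; congr (_ - _).
  by apply: eq_bigr => j _; rewrite mevalZ mevalXU mulrC.
by rewrite mulmxDl addrK mulmxK.
Qed.

Lemma mdvd_sum I (r : seq I) (Q : pred I) (F : I -> {mpoly k[2]}) h :
  (forall i, Q i -> mdvd h (F i)) -> mdvd h (\sum_(i <- r | Q i) F i).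
Proof.
move=> dvdF; elim/big_rec: _ => [|i p /dvdF[q ->] [q' ->]].
  by exists 0; rewrite mul0r.
by exists (q + q'); rewrite mulrDl.
Qed.

Lemma mult_le P f m : m \in msupp (expand P f) -> (mult P f <= mdeg m)%N.
Proof.
rewrite /mult; elim: (msupp _) => //= m' s IH; rewrite inE big_cons geq_min.
by case/predU1P => [->|/IH ->]; rewrite ?leqnn ?orbT.
Qed.

Lemma comp_mpolyA f (a b : 2.-tuple {mpoly k[2]}) :
  (f \mPo a) \mPo b = f \mPo [tuple tnth a i \mPo b | i < 2].
Proof.
rewrite [f]mpolyE [_ \mPo a]raddf_sum [LHS]raddf_sum [RHS]raddf_sum /=; apply: eq_bigr => m _.
rewrite !linearZ /= !comp_mpolyX rmorph_prod /=; congr (_ *: _).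
by apply: eq_bigr => i _; rewrite rmorphXn /= tnth_mktuple.
Qed.

Lemma comp_expand P f (a b : {mpoly k[2]}) :
  f \mPo [tuple (P 0 0)%:MP + a; (P 0 1)%:MP + b] =
  \sum_(m <- msupp (expand P f)) (expand P f)@_m *: (a ^+ m 0 * b ^+ m 1).
Proof.
transitivity (expand P f \mPo [tuple a; b]).
  rewrite comp_mpolyA; congr comp_mpoly; apply: eq_from_tnth => i.
  rewrite !tnth_mktuple raddfD /= comp_mpolyC comp_mpolyXU -tnth_nth.
  by case: i => [[|[|i]] lti] //=; rewrite !(tnth_nth 0) /= addrC;
    congr (_ + (P 0 _)%:MP); apply: val_inj.
rewrite comp_mpolyEX; apply: eq_bigr => m _.
rewrite comp_mpolyX big_ord_recl big_ord1 /=.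
by rewrite (_ : lift ord0 ord0 = 1) //; apply: val_inj.
Qed.

Lemma mquotE f h : mdvd h f -> mquot f h * h = f.
Proof. by case=> q fE; apply: (@xgetPex _ 0 [set q | q * h = f]%classic); exists q; rewrite /= fE. Qed.

(* The divisions defining the strict transform are exact. *)
Lemma strict_transform0E P z f : let u := 'X_0 - (P 0 0)%:MP in
  strict_transform P (Some z) f * u ^+ mult P f =
  f \mPo [tuple 'X_0; (P 0 1)%:MP + u * 'X_1].
Proof.
move=> u; rewrite /= -/u mquotE //.
have -> : 'X_0 = (P 0 0)%:MP + u :> {mpoly k[2]} by rewrite addrC subrK.
rewrite comp_expand big_seq; apply: mdvd_sum => m /mult_le le_m.
exists ((expand P f)@_m *: (u ^+ (mdeg m - mult P f) * 'X_1 ^+ m 1)).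
rewrite -scalerAl mulrAC -exprD subnK // exprMn mulrA -exprD.
rewrite mdegE big_ord_recl big_ord1 /=.
by rewrite (_ : lift ord0 ord0 = 1) //; apply: val_inj.
Qed.

Lemma strict_transform1E P f : let v := 'X_1 - (P 0 1)%:MP in
  strict_transform P None f * v ^+ mult P f =
  f \mPo [tuple (P 0 0)%:MP + v * 'X_0; 'X_1].
Proof.
move=> v; rewrite /= -/v mquotE //.
have -> : 'X_1 = (P 0 1)%:MP + v :> {mpoly k[2]} by rewrite addrC subrK.
rewrite comp_expand big_seq; apply: mdvd_sum => m /mult_le le_m.
exists ((expand P f)@_m *: (v ^+ (mdeg m - mult P f) * 'X_0 ^+ m 0)).
rewrite -scalerAl mulrAC -exprD subnK // exprMn mulrAC -exprD.
rewrite mdegE big_ord_recl big_ord1 /=.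
by rewrite (_ : lift ord0 ord0 = 1) //; apply: val_inj.
Qed.

Lemma expand_eq0 P f : (expand P f == 0) = (f == 0).
Proof.
apply/idP/idP => /eqP E; apply/eqP; last by rewrite E /expand raddf0.
have := comp_expand P f ('X_0 - (P 0 0)%:MP) ('X_1 - (P 0 1)%:MP).
rewrite E msupp0 big_nil !(addrC _%:MP) !subrK => <-.
rewrite -[LHS]comp_mpoly_id; congr comp_mpoly; apply: eq_from_tnth => i.
rewrite tnth_mktuple !(tnth_nth 0).
by case: i => [[|[|i]] lti] //=; congr ('X_[U_( _ )]); apply: val_inj.
Qed.

Lemma mult_attained P f : f != 0 ->
  exists2 m, m \in msupp (expand P f) & mdeg m = mult P f.
Proof.
rewrite -(expand_eq0 P) -msupp_eq0 /mult.
have : forall m, m \in msupp (expand P f) -> (mdeg m < msize (expand P f))%N.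
  by move=> m; apply: msize_mdeg_lt.
elim: (msupp _) => //= m s IH lt _; rewrite big_cons.
case: (eqVneq s [::]) => [->|s0].
  rewrite big_nil; exists m; rewrite ?inE //; apply/esym/minn_idPl/ltnW/lt.
  by rewrite inE eqxx.
have lt' m' : m' \in s -> (mdeg m' < msize (expand P f))%N.
  by move=> m's; apply: lt; rewrite inE m's orbT.
have [m' m's m'E] := IH lt' s0; rewrite -m'E.
case: leqP => _; first by exists m; rewrite ?inE ?eqxx.
by exists m'; rewrite ?inE ?m's ?orbT.
Qed.

Lemma exc_finite P f : f != 0 -> finite_set [set d | inf_near P f d]%classic.
Proof.
move=> f0.
pose S := msupp (expand P f).
pose q : {poly k} := \sum_(m <- S | mdeg m == mult P f) (expand P f)@_m *: 'X^(m 1).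
have q0 : q != 0.
  have [m mS mm] := mult_attained P f0.
  apply/eqP => /(congr1 (fun p : {poly k} => p`_(m 1))).
  rewrite coef0 coef_sum big_mkcond (bigD1_seq m) ?msupp_uniq //= mm eqxx coefZ coefXn eqxx mulr1.
  rewrite big1_seq ?addr0.
    by move/eqP; rewrite mcoeff_eq0 mS.
  move=> m' /andP[ne _]; case: eqP => // m'm; rewrite coefZ coefXn; case: eqP; rewrite ?mulr0 // => e.
  case/eqP: ne; apply/mnmP => i.
  have : mdeg m' = mdeg m by rewrite m'm mm.
  rewrite !mdegE !big_ord_recl !big_ord0 !addn0 (_ : lift ord0 ord0 = 1); last exact: val_inj.
  rewrite -e => /addIn e0; case: i => [[|[|i]] lti] //.
    by rewrite (_ : Ordinal lti = ord0) //; apply: val_inj.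
  by rewrite (_ : Ordinal lti = 1) //; apply: val_inj.
have fin : finite_set [set z | root q z]%classic.
  apply: contrapT => /(infinite_set_fset (size q)) [B subB].
  rewrite leqNgt => /negP; apply.
  apply: max_poly_roots q0 _ (fset_uniq B).
  by apply/allP => z zB; apply: subB.
have qE z : (strict_transform P (Some z) f).@[exc_point P (Some z) 0] = q.[z].
  pose u : {mpoly k[2]} := 'X_0 - (P 0 0)%:MP.
  have u0 : u ^+ mult P f != 0.
    rewrite expf_neq0 // subr_eq0; apply/eqP => /(congr1 (meval (fun=> P 0 0 + 1))).
    by rewrite mevalXU mevalC => /eqP; rewrite -subr_eq0 addrAC subrr add0r oner_eq0.
  have -> : strict_transform P (Some z) f = \sum_(m <- S)
     (expand P f)@_m *: (u ^+ (mdeg m - mult P f) * 'X_1 ^+ m 1).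
    apply: (mulIf u0); rewrite strict_transform0E -/u.
    have -> : 'X_0 = (P 0 0)%:MP + u :> {mpoly k[2]} by rewrite addrC subrK.
    rewrite comp_expand mulr_suml; apply: eq_big_seq => m /mult_le le_m.
    rewrite -scalerAl mulrAC -exprD subnK // exprMn mulrA -exprD.
    rewrite mdegE big_ord_recl big_ord1 /=.
    by rewrite (_ : lift ord0 ord0 = 1) //; apply: val_inj.
  rewrite raddf_sum horner_sum [RHS]big_mkcond /=; apply: eq_big_seq => m mS.
  have le_m := mult_le mS.
  rewrite mevalZ mevalM !rmorphXn /= mevalB mevalC !mevalXU !mxE !(tnth_nth 0) /= subrr.
  rewrite expr0n subn_eq0 [in LHS]leq_eqVlt ltnNge le_m orbF.
  by case: ifP => _; rewrite ?mul0r ?mulr0 // hornerZ hornerXn mul1r.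
apply: (@sub_finite_set _ _ ([set None] `|` Some @` [set z | root q z])%classic).
  case=> [z|] /= near; last by left.
  by right; exists z => //=; rewrite /root -qE.
by rewrite finite_setU; split; [exact: finite_set1|exact: finite_image].
Qed.

Lemma near_finite P f g : ~ share_component P f g ->
  finite_set [set d | inf_near P f d && inf_near P g d]%classic.
Proof.
move=> nsh; case: (eqVneq f 0) => [f0|f0].
  case: (eqVneq g 0) => [g0|g0].
    case: nsh; exists ('X_0 - (P 0 0)%:MP); rewrite f0 g0; split.
    - rewrite /nonconstant ltnNge; apply/negP => le1.
      have [c E] : exists c, 'X_0 - (P 0 0)%:MP = c%:MP :> {mpoly k[2]}.
        by eexists; apply: msize1_polyC.
      have := congr1 (meval (fun=> P 0 0 + 1)) E.
      have := congr1 (meval (fun=> P 0 0)) E.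
      rewrite !mevalB !mevalC !mevalXU subrr => <- /eqP.
      by rewrite addrAC subrr add0r oner_eq0.
    - by rewrite /on_curve mevalB mevalC mevalXU subrr.
    - by exists 0; rewrite mul0r.
    - by exists 0; rewrite mul0r.
  by apply: sub_finite_set (exc_finite P g0) => d /andP[].
by apply: sub_finite_set (exc_finite P f0) => d /andP[].
Qed.

Lemma B_uptoS n P f g : B_upto n.+1 P f g =
  if `[< share_component P f g >] then None
  else if ~~ (on_curve f P && on_curve g P) then Some 0%N
  else eadd (Some (mult P f * mult P g)%N)
      (\big[eadd/Some 0%N]_(d \in [set d | inf_near P f d && inf_near P g d]%classic)
         B_upto n (exc_point P d) (strict_transform P d f)
                                   (strict_transform P d g)).
Proof. by []. Qed.

Lemma B_mono P f g : nondecr (fun n => B_upto n P f g).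
Proof.
suff S n : forall P f g, ele (B_upto n P f g) (B_upto n.+1 P f g).
  by move=> n p /subnK<-; elim: (p - n)%N => [|i IH]; [exact: ele_refl|exact: ele_trans IH (S _ _ _ _)].
elim: n => [|n IH] {}P {}f {}g.
  by case: (B_upto 1 P f g).
rewrite B_uptoS [B_upto n.+2 _ _ _]B_uptoS.
case: asboolP => [//|nsh]; case: ifP => [_|_]; first exact: ele_refl.
apply: ele_add; first exact: ele_refl.
rewrite !fsbig_finite; try exact: near_finite.
elim: (enum_fset _) => [|d r IHr]; first by rewrite !big_nil.
by rewrite !big_cons; apply: ele_add => //; apply: IH.
Qed.

Lemma B_rec P f g : B_number P f g =
  if `[< share_component P f g >] then None
  else if ~~ (on_curve f P && on_curve g P) then Some 0%N
  else eadd (Some (mult P f * mult P g)%N)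
      (\big[eadd/Some 0%N]_(d \in [set d | inf_near P f d && inf_near P g d]%classic)
         B_number (exc_point P d) (strict_transform P d f)
                                   (strict_transform P d g)).
Proof.
have -> : B_number P f g = esup (fun n => B_upto n.+1 P f g).
  apply: ele_anti; apply: esup_le => n; last exact: (esup_ub (fun n => B_upto n P f g)).
  by apply: ele_trans (esup_ub _ n); apply: B_mono.
under [X in esup X]funext => n do rewrite B_uptoS.
case: asboolP => [_|nsh]; first exact: esupC.
case: ifP => _; first exact: esupC.
rewrite fsbig_finite; last exact: near_finite.
rewrite -esup_sum; last by move=> d; exact: B_mono.
rewrite -[X in _ = eadd X _]esupC.
rewrite -esupD; [|by move=> *; exact: ele_refl|by apply: mono_sum => d; exact: B_mono].
congr esup; apply: funext => n; congr eadd.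
by rewrite fsbig_finite //; exact: near_finite.
Qed.

End PlaneCurvesTheory.

(* Main.v *)
(* Fix I and put J_P(f, g) = m_P(f) m_P(g) + sum_Q I_Q(f', g'), the sum over the
   first order infinitely near points Q.  On each chart the total transform of g
   is u^(m_P(g)) g', u = 0 being the exceptional line, and sum_Q I_Q(f', u) is
   the degree m_P(f) of the lowest form of f.  Hence J_P(f, g) is the sum over Q
   of the I_Q(f', total transform of g), which is visibly additive in g and
   invariant under g -> g + h f; it is moreover symmetric, and equal to 1 for
   the two coordinate lines through P.  Fulton's algorithm computes any function
   with these properties, so J_P = I_P wherever I_P is finite.  Thus I satisfies
   the recursion defining B, and m_P(f) m_P(g) > 0 makes the recursion descend
   along the value of I. *)
Require Import Defs.
From HB Require Import structures.
From mathcomp Require Import all_boot all_order all_algebra.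
From mathcomp Require Import boolp classical_sets cardinality fsbigop.
From mathcomp Require Import mpoly zify.
Import GRing.Theory.
Set Implicit Arguments.
Unset Strict Implicit.
Unset Printing Implicit Defensive.
Local Open Scope ring_scope.

(** * Restriction to a coordinate line *)

Lemma ord2_other (i j l : 'I_2) : i != j -> l != i -> l = j.
Proof.
by case: i j l => [[|[|]] // ?] [[|[|]] // ?] [[|[|]] // ?] // _ _; apply: val_inj.
Qed.

Section Slices.
Variable k : fieldType.
Implicit Types (f g h : {mpoly k[2]}) (P : 'rV[k]_2) (p q : {poly k}) (i j : 'I_2).

(* The restriction of f to the line X_i = c, in the other coordinate. *)
Definition slice i (c : k) f : {poly k} :=
  mmap polyC (fun j => if j == i then c%:P else 'X) f.

HB.instance Definition _ i c := GRing.RMorphism.copy (slice i c)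
  (mmap polyC (fun j => if j == i then c%:P else 'X)).

(** The inclusion of k[X_j] in k[x, y]: a polynomial on a coordinate line is extended constantly in
    the other direction. *)
Definition embed j p : {mpoly k[2]} := (map_poly (@mpolyC 2 k) p).['X_j].

HB.instance Definition _ j := GRing.RMorphism.copy (embed j)
  (horner_eval 'X_j \o map_poly (@mpolyC 2 k)).

Lemma embedX j : embed j 'X = 'X_j.
Proof. by rewrite /embed map_polyX hornerX. Qed.

Lemma embedC j c : embed j c%:P = c%:MP.
Proof. by rewrite /embed map_polyC hornerC. Qed.

Lemma sliceC i c a : slice i c a%:MP = a%:P.
Proof. by rewrite /slice mmapC. Qed.

Lemma sliceX i c j : slice i c 'X_j = if j == i then c%:P else 'X.
Proof. by rewrite /slice mmapX mmap1U. Qed.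

Lemma sliceZ i c a f : slice i c (a *: f) = a *: slice i c f.
Proof. by rewrite -mul_mpolyC rmorphM /= sliceC mul_polyC. Qed.

Lemma slice_embed i j c p : i != j -> slice i c (embed j p) = p.
Proof.
move=> ij; elim/poly_ind: p => [|p a IH]; first by rewrite !rmorph0.
by rewrite !(rmorphD, rmorphM) /= IH embedX embedC sliceC sliceX eq_sym (negPf ij).
Qed.

Lemma embed_eq0 i p : (embed i p == 0) = (p == 0).
Proof.
apply/eqP/eqP => [e|->]; last exact: rmorph0.
have [j ij] : exists j : 'I_2, j != i by exists (rev_ord i); case: i {e} => [[|[|]]].
by rewrite -(slice_embed 0 p ij) e rmorph0.
Qed.

Lemma eval_slice i j P f : i != j -> (slice i (P 0 i) f).[P 0 j] = f.@[P 0].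
Proof.
move=> ij; elim/mpolyind: f => [|c m p _ _ IH]; first by rewrite !rmorph0 horner0.
rewrite rmorphD /= hornerD mevalD IH sliceZ hornerZ mevalZ.
congr (_ * _ + _); rewrite mpolyXE_id !rmorph_prod horner_prod /=.
apply: eq_bigr => l _; rewrite !rmorphXn /= horner_exp sliceX mevalXU.
case: eqP => [->|/eqP li]; rewrite ?hornerC ?hornerX //.
by rewrite (ord2_other ij li).
Qed.

(** Modulo X_i - c, restricting and re-embedding fixes constants and both variables. The polynomials
    fixed by it form a subring, hence are all of k[x, y]. *)
Lemma slice_divides i j c f : i != j ->
  exists h, f = h * ('X_i - c%:MP) + embed j (slice i c f).
Proof.
move=> ij; have ji : j != i by rewrite eq_sym.
pose D f := mdvd ('X_i - c%:MP) (f - embed j (slice i c f)).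
suff: D f by case=> h E; exists h; rewrite -E subrK.
have D_const a : D a%:MP by exists 0; rewrite sliceC embedC subrr mul0r.
have D_add u v : D u -> D v -> D (u + v).
  case=> [a E] [b F]; exists (a + b); rewrite !rmorphD /= mulrDl -E -F.
  by rewrite opprD addrACA.
have D_mul u v : D u -> D v -> D (u * v).
  case=> [a E] [b F]; rewrite /D !rmorphM /=.
  exists (a * v + embed j (slice i c u) * b).
  rewrite mulrDl mulrAC -E -mulrA -F mulrBl mulrBr.
  by rewrite addrA subrK.
have D_X l : D 'X_l.
  rewrite /D sliceX; case: eqP => [->|/eqP li].
    by exists 1; rewrite embedC mul1r.
  by rewrite (ord2_other ij li); exists 0; rewrite embedX subrr mul0r.
elim/mpolyind: f => [|a m p _ _ IH]; first by rewrite -mpolyC0.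
apply: (D_add) => //; rewrite -mul_mpolyC; apply: (D_mul) => //.
rewrite mpolyXE_id; apply: (big_rec D) => [|l u _ Du]; first by rewrite -mpolyC1.
apply: (D_mul) => //; elim: (m l) => [|e IHe]; first by rewrite expr0 -mpolyC1.
by rewrite exprS; apply: (D_mul).
Qed.

End Slices.

(** * Uniqueness of the intersection number at a point *)

Section LocalNumber.
Variables (k : closedFieldType) (P : 'rV[k]_2).
Implicit Types (f g h : {mpoly k[2]}) (p q : {poly k}) (i j : 'I_2).
Implicit Types W : {mpoly k[2]} -> {mpoly k[2]} -> enat.

(** What Fulton's algorithm computes with at the fixed point P. The arguments are non-zero rather
    than non-constant, because strict transforms may be non-zero constants. *)
Record local_number W : Prop := {
  local_unit : forall f g, f != 0 -> g != 0 -> ~~ on_curve f P -> W f g = Some 0%N;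
  local_sym : forall f g, f != 0 -> g != 0 -> W f g = W g f;
  local_mul : forall f1 f2 g, f1 != 0 -> f2 != 0 -> g != 0 ->
    W (f1 * f2) g = eadd (W f1 g) (W f2 g);
  local_add : forall f g h, f != 0 -> g != 0 -> g + h * f != 0 ->
    W f g = W f (g + h * f);
  local_one : W ('X_0 - (P 0 0)%:MP) ('X_1 - (P 0 1)%:MP) = Some 1%N }.

Lemma mvar_neq0 i (c : k) : 'X_i - c%:MP != 0 :> {mpoly k[2]}.
Proof.
apply/eqP => /(congr1 (meval (fun=> c + 1))) /eqP.
by rewrite mevalB mevalXU mevalC meval0 addrAC subrr add0r oner_eq0.
Qed.

Lemma mvar_on i : on_curve ('X_i - (P 0 i)%:MP) P.
Proof. by rewrite /on_curve mevalB mevalXU mevalC subrr. Qed.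

Section Theory.
Variable W : {mpoly k[2]} -> {mpoly k[2]} -> enat.
Hypothesis locW : local_number W.

Lemma local_exp f g n : f != 0 -> g != 0 ->
  W (f ^+ n) g = iter n (eadd (W f g)) (Some 0%N).
Proof.
move=> f0 g0; elim: n => [|n IH].
  by rewrite (local_unit locW) ?oner_eq0 // /on_curve meval1 oner_eq0.
by rewrite exprS (local_mul locW) ?expf_neq0 // IH.
Qed.

Lemma local_mulr_exp f g h n : f != 0 -> g != 0 -> h != 0 ->
  W f (g * h ^+ n) = eadd (iter n (eadd (W f h)) (Some 0%N)) (W f g).
Proof.
move=> f0 g0 h0; have hn0 : h ^+ n != 0 by rewrite expf_neq0.
rewrite (local_sym locW f0) ?mulf_neq0 // (local_mul locW) // eaddC.
by rewrite (local_exp n h0 f0) (local_sym locW f0 h0) (local_sym locW f0 g0).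
Qed.

Lemma local_mulr f g h : f != 0 -> g != 0 -> h != 0 ->
  W f (g * h) = eadd (W f g) (W f h).
Proof.
move=> f0 g0 h0; rewrite (local_sym locW f0 (mulf_neq0 g0 h0)) (local_mul locW) //.
by rewrite (local_sym locW g0 f0) (local_sym locW h0 f0).
Qed.

Lemma local_one_sym i j : i != j ->
  W ('X_j - (P 0 j)%:MP) ('X_i - (P 0 i)%:MP) = Some 1%N.
Proof.
have [ij _|] := eqVneq (i, j) (0, 1).
  by rewrite (local_sym locW) ?mvar_neq0 //; case: ij => -> ->; exact: local_one.
have [ij _ _|] := eqVneq (i, j) (1, 0); first by case: ij => -> ->; exact: local_one.
by case: i j => [[|[|]] // ?] [[|[|]] // ?].
Qed.

Lemma local_embed_lin i j a : i != j ->
  W (embed j ('X - a%:P)) ('X_i - (P 0 i)%:MP) = Some (a == P 0 j : nat).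
Proof.
move=> ij; rewrite rmorphB /= embedX embedC.
case: eqP => [->|/eqP ne]; first exact: local_one_sym.
rewrite (local_unit locW) ?mvar_neq0 //.
by rewrite /on_curve mevalB mevalXU mevalC subr_eq0 eq_sym.
Qed.

(** By additivity each factor X - a contributes separately: 1 if its line passes through P, 0
    otherwise. *)
Lemma local_embed i j c (r : seq k) : i != j -> c != 0 ->
  W (embed j (c *: \prod_(a <- r) ('X - a%:P))) ('X_i - (P 0 i)%:MP) =
  Some (count_mem (P 0 j) r).
Proof.
move=> ij c0; elim: r => [|a r IH].
  rewrite big_nil alg_polyC embedC (local_unit locW) ?mvar_neq0 ?mpolyC_eq0 //.
  by rewrite /on_curve mevalC.
rewrite big_cons scalerAr rmorphM (local_mul locW) ?mvar_neq0 ?embed_eq0 ?polyXsubC_eq0 //.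
  by rewrite IH local_embed_lin.
by rewrite scaler_eq0 negb_or c0 prodf_seq_neq0 /=; apply/allP => b _; rewrite polyXsubC_eq0.
Qed.

(** By [slice_divides], f and its restriction differ by a multiple of X_i - p_i, which [local_add]
    absorbs once symmetry has put the line first. *)
Lemma local_slice i j f : i != j -> slice i (P 0 i) f != 0 ->
  W f ('X_i - (P 0 i)%:MP) = W (embed j (slice i (P 0 i) f)) ('X_i - (P 0 i)%:MP).
Proof.
move=> ij s0; have f0 : f != 0 by apply: contraNneq s0 => ->; rewrite rmorph0.
have X0 := mvar_neq0 i (P 0 i).
rewrite [LHS](local_sym locW) // [RHS](local_sym locW) ?embed_eq0 //.
have [h E] := slice_divides (P 0 i) f ij.
rewrite addrC in E.
by rewrite [RHS](local_add locW (h := h)) ?embed_eq0 -?E.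
Qed.

End Theory.

(* Fulton's algorithm: an outer induction on the value n, used when y - p2
   divides f, and an inner one where g(x, p2) is divided by f(x, p2). *)
Lemma local_number_unique W0 W f g n :
  local_number W0 -> local_number W ->
  (forall f g, f != 0 -> g != 0 -> on_curve f P -> on_curve g P ->
    W0 f g <> Some 0%N) ->
  (forall f h, f != 0 -> h != 0 -> on_curve f P -> W0 f (h * f) = None) ->
  f != 0 -> g != 0 -> W0 f g = Some n -> W f g = Some n.
Proof.
move=> loc0 locW W0_pos W0_inf.
elim/ltn_ind: n f g => n IHn f g f0 g0.
have X0 := mvar_neq0 1 (P 0 1).
have [fP|fP] := boolP (on_curve f P); last first.
  by rewrite (local_unit loc0) // (local_unit locW).
have [gP|gP] := boolP (on_curve g P); last first.
  by rewrite (local_sym loc0) // (local_unit loc0) // (local_sym locW) // (local_unit locW).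
pose s := slice 1 (P 0 1).
have [N] := ubnP (size (s f) + size (s g)).
elim: N f g f0 g0 fP gP => // N IHN f g f0 g0 fP gP ltN W0n.
wlog le_fg : f g f0 g0 fP gP ltN W0n / (size (s f) <= size (s g))%N.
  move=> H; case/orP: (leq_total (size (s f)) (size (s g))) => le; first exact: H.
  by rewrite (local_sym locW) //; apply: H => //; rewrite 1?addnC // (local_sym loc0).
have [sf0|sf0] := eqVneq (s f) 0.
  have [h] := slice_divides (P 0 1) f (isT : (1 : 'I_2) != 0).
  rewrite -/(s f) sf0 rmorph0 addr0 => fE.
  have h0 : h != 0 by apply: contraNneq f0; rewrite fE => ->; rewrite mul0r.
  move: W0n; rewrite fE (local_mul loc0) // (local_mul locW) //.
  case Wh: (W0 h g) => [a|] //; case WX: (W0 _ g) => [b|] //= -[nE].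
  (* The line y = p2 meets g at P, so it takes a positive part of n and the outer induction covers
     the cofactor h. *)
  have b0 : (0 < b)%N.
    by rewrite lt0n; apply/eqP => b0; case: (W0_pos _ _ X0 g0 (mvar_on 1) gP); rewrite WX b0.
  rewrite (IHn a _ h g) //; last by rewrite -nE -[X in (X < _)%N]addn0 ltn_add2l.
  suff -> : W ('X_1 - (P 0 1)%:MP) g = Some b by rewrite -nE.
  (* Otherwise g would be a multiple of y - p2, and the value in [WX] infinite. *)
  have sg0 : s g != 0.
    apply/eqP => sg; have [l] := slice_divides (P 0 1) g (isT : (1 : 'I_2) != 0).
    rewrite -/(s g) sg rmorph0 addr0 => gE.
    move: WX; rewrite gE W0_inf ?mvar_on //.
    by apply: contraNneq g0; rewrite gE => ->; rewrite mul0r.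
  (* Both functions give the order of vanishing of g(x, p2) at p1. *)
  rewrite -WX [LHS](local_sym locW) // [RHS](local_sym loc0) //.
  rewrite (local_slice locW (isT : (1 : 'I_2) != 0)) //.
  rewrite (local_slice loc0 (isT : (1 : 'I_2) != 0)) //.
  have [r rE] := closed_field_poly_normal (s g).
  rewrite -/(s g) rE !local_embed ?lead_coef_eq0 //.
(* With this lift of the Euclidean quotient, g + h f restricts to the remainder of g(x, p2) by f(x,
   p2), which is smaller than both. *)
pose h := - embed 0 (s g %/ s f).
have sg1 : s (g + h * f) = s g %% s f.
  rewrite [LHS]rmorphD rmorphM rmorphN /= slice_embed // -/(s f) -/(s g).
  by rewrite {1}(divp_eq (s g) (s f)) mulNr addrAC subrr add0r.
have g1P : on_curve (g + h * f) P.
  by rewrite /on_curve mevalD mevalM (eqP fP) (eqP gP) mulr0 addr0.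
(* On multiples of f the value is infinite; hence g + h f is non-zero and the inner induction
   applies. *)
have ndvd l : g != l * f.
  apply/eqP => gE; move: W0n; rewrite gE W0_inf //.
  by apply: contraNneq g0; rewrite gE => ->; rewrite mul0r.
have g10 : g + h * f != 0 by rewrite addr_eq0 -mulNr.
rewrite (local_add locW (h := h)) //; apply: IHN => //.
  rewrite sg1 -ltnS; apply: leq_trans ltN; rewrite ltnS.
  by rewrite -addnS leq_add2l; apply: leq_trans le_fg; rewrite ltn_modp.
by rewrite -(local_add loc0).
Qed.

End LocalNumber.

(** * Noether's formula for one blowup *)

Lemma fsbig_andr (T : choiceType) (p q : pred T) (F : T -> enat) :
  (forall x, ~~ q x -> F x = Some 0%N) ->
  \big[eadd/Some 0%N]_(x \in [set x | p x && q x]%classic) F x =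
  \big[eadd/Some 0%N]_(x \in [set x | p x]%classic) F x.
Proof.
move=> F_off; apply: fsbig_widen => [x /andP[] //|x [/= px /negP]].
by rewrite px => /F_off.
Qed.

Lemma eq_fsbig_andC (T : choiceType) (p q : pred T) (F G : T -> enat) :
  F =1 G ->
  \big[eadd/Some 0%N]_(x \in [set x | p x && q x]%classic) F x =
  \big[eadd/Some 0%N]_(x \in [set x | q x && p x]%classic) G x.
Proof.
by move=> /funext ->; apply: eq_fsbigl; rewrite predeqE => x /=; rewrite andbC.
Qed.

Lemma eq_fsbig_split (T : choiceType) (D : set T) (F G H : T -> enat) :
  finite_set D -> (forall x, F x = eadd (G x) (H x)) ->
  \big[eadd/Some 0%N]_(x \in D) F x =
  eadd (\big[eadd/Some 0%N]_(x \in D) G x) (\big[eadd/Some 0%N]_(x \in D) H x).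
Proof.
move=> finD FGH; rewrite !fsbig_finite // -big_split.
by apply: eq_bigr => x _; exact: FGH.
Qed.

Section Blowup.
Variables (k : closedFieldType) (P : 'rV[k]_2).
Implicit Types (f g h : {mpoly k[2]}) (d : option k).

(* In the chart of d the exceptional line is X_(exc_var d) = const, and it is
   parametrized by X_(exc_par d). *)
Definition exc_var d : 'I_2 := if d is Some _ then 0 else 1.
Definition exc_par d : 'I_2 := if d is Some _ then 1 else 0.

Lemma exc_var_par d : exc_var d != exc_par d.
Proof. by case: d. Qed.

Definition exc_eq d : {mpoly k[2]} := 'X_(exc_var d) - (P 0 (exc_var d))%:MP.

(** The projection of the blowup in the chart of d; composition with it gives the total
    transform. *)
Definition blowup_map d : 2.-tuple {mpoly k[2]} :=
  match d with
  | Some _ => [tuple 'X_0; (P 0 1)%:MP + exc_eq d * 'X_1]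
  | None => [tuple (P 0 0)%:MP + exc_eq d * 'X_0; 'X_1]
  end.

Definition pullback d f := f \mPo blowup_map d.

Lemma pullbackM d f g : pullback d (f * g) = pullback d f * pullback d g.
Proof. exact: rmorphM. Qed.

Lemma exc_point_var d : exc_point P d 0 (exc_var d) = P 0 (exc_var d).
Proof. by case: d => [z|]; rewrite mxE (tnth_nth 0). Qed.

Lemma exc_point_par d : exc_point P d 0 (exc_par d) = odflt 0 d.
Proof. by case: d => [z|]; rewrite mxE (tnth_nth 0). Qed.

Lemma pullback_strict d f :
  pullback d f = strict_transform P d f * exc_eq d ^+ mult P f.
Proof. by case: d => [z|]; rewrite ?strict_transform0E ?strict_transform1E. Qed.

Lemma pullback_eval d f : (pullback d f).@[exc_point P d 0] = f.@[P 0].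
Proof.
rewrite comp_mpoly_meval; apply: meval_eq => i; rewrite (tnth_nth 0).
case: d i => [z|] [[|[|]] // lti] /=;
  rewrite ?(mevalB, mevalD, mevalM, mevalC, mevalXU) !mxE !(tnth_nth 0) /=
    ?subrr ?mul0r ?addr0; congr (P _ _); exact: val_inj.
Qed.

(* The lowest form of f with the coordinate other than X_j set to 1. *)
Definition lowest_at (j : 'I_2) f : {poly k} :=
  \sum_(m <- msupp (expand P f) | mdeg m == mult P f) (expand P f)@_m *: 'X^(m j).

Lemma mdeg2 (m : 'X_{1..2}) : mdeg m = (m 0%R + m 1%R)%N.
Proof.
rewrite mdegE big_ord_recl big_ord1 /=.
by rewrite (_ : lift ord0 ord0 = 1) //; apply: val_inj.
Qed.

(** A term of degree e in the expansion at P acquires u^e in the chart, u = [exc_eq d]. After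
    division by u^m only the terms with e = m survive on u = 0. *)
Lemma strict_slice d f :
  slice (exc_var d) (P 0 (exc_var d)) (strict_transform P d f) =
  lowest_at (exc_par d) f.
Proof.
(* In the chart, x - p1 = u a and y - p2 = u b. *)
pose a : {mpoly k[2]} := if d is Some _ then 1 else 'X_0.
pose b : {mpoly k[2]} := if d is Some _ then 'X_1 else 1.
have u0 : exc_eq d ^+ mult P f != 0 by rewrite expf_neq0 ?mvar_neq0.
have -> : strict_transform P d f = \sum_(m <- msupp (expand P f))
    (expand P f)@_m *: (exc_eq d ^+ (mdeg m - mult P f) * (a ^+ m 0 * b ^+ m 1)).
  apply: (mulIf u0); rewrite -pullback_strict.
  have -> : pullback d f =
      f \mPo [tuple (P 0 0)%:MP + exc_eq d * a; (P 0 1)%:MP + exc_eq d * b].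
    congr comp_mpoly; apply: eq_from_tnth => i; rewrite !(tnth_nth 0) /blowup_map /a /b.
    by case: d {u0 a b} i => [z|] [[|[|]] // lti] //=; rewrite mulr1 /exc_eq addrC subrK.
  rewrite comp_expand mulr_suml; apply: eq_big_seq => m /mult_le le_m.
  by rewrite -scalerAl mulrAC -exprD subnK // !exprMn mulrACA -exprD -mdeg2.
rewrite [LHS]raddf_sum [RHS]big_mkcond /=; apply: eq_big_seq => m /mult_le le_m.
rewrite sliceZ !rmorphM !rmorphXn /= rmorphB /= sliceX eqxx sliceC subrr.
rewrite expr0n subn_eq0 [in LHS]leq_eqVlt ltnNge le_m orbF.
case: ifP => _; last by rewrite mul0r scaler0.
rewrite mul1r; congr (_ *: _); rewrite /a /b.
by case: (d) => [z|] /=; rewrite sliceX rmorph1 expr1n ?mul1r ?mulr1.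
Qed.

Lemma coef_lowest j f i : (lowest_at j f)`_i =
  \sum_(m <- msupp (expand P f) | (mdeg m == mult P f) && (m j == i)) (expand P f)@_m.
Proof.
rewrite coef_sum big_mkcondr /=; apply: eq_bigr => m _.
by rewrite coefZ coefXn eq_sym; case: eqP; rewrite ?mulr1 ?mulr0.
Qed.

Lemma coef_lowest_gt j f i : (mult P f < i)%N -> (lowest_at j f)`_i = 0.
Proof.
move=> lt; rewrite coef_lowest big1 // => m /andP[/eqP mE /eqP mi].
suff : (m j <= mult P f)%N by rewrite mi leqNgt lt.
rewrite -mE mdeg2; case: j {mi} => [[|[|]] // lt01].
  by rewrite (_ : Ordinal lt01 = 0) ?leq_addr //; apply: val_inj.
by rewrite (_ : Ordinal lt01 = 1) ?leq_addl //; apply: val_inj.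
Qed.

(** In a form of degree m the two exponents add up to m, so its two dehomogenizations list the same
    coefficients in opposite order. *)
Lemma lowest_rev f i : (i <= mult P f)%N ->
  (lowest_at 0 f)`_i = (lowest_at 1 f)`_(mult P f - i).
Proof.
move=> le; rewrite !coef_lowest; apply: eq_bigl => m; case: eqP => //= mE.
by move: le; rewrite -mE mdeg2 => le; apply/eqP/eqP; lia.
Qed.

(** Monomials of equal degree in two variables are told apart by one exponent, so dehomogenizing
    cancels nothing. *)
Lemma lowest_neq0 j f : f != 0 -> lowest_at j f != 0.
Proof.
move=> f0; have [m mS mm] := mult_attained P f0.
apply/eqP => /(congr1 (fun p : {poly k} => p`_(m j))).
rewrite coef0 coef_lowest big_mkcond (bigD1_seq m) ?msupp_uniq //= mm !eqxx /=.
rewrite big1_seq ?addr0; first by move/eqP; rewrite mcoeff_eq0 mS.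
move=> m' /andP[ne _]; case: eqP => //= m'm; case: eqP => // e.
case/eqP: ne; have : mdeg m' = mdeg m by rewrite m'm mm.
rewrite !mdeg2 => {}m'm.
have [e0 e1] : m' 0 = m 0 /\ m' 1 = m 1.
  have : j = 0 \/ j = 1.
    by case: j {e} => [[|[|]] // ?]; [left|right]; apply: val_inj.
  by move: m'm e => + + [] jE; rewrite jE; lia.
apply/mnmP => l; case: (eqVneq l 0) => [->//|l0].
by rewrite (ord2_other (isT : (0 : 'I_2) != 1) l0).
Qed.

Lemma exc_eq_neq0 d : exc_eq d != 0.
Proof. exact: mvar_neq0. Qed.

Lemma strict_neq0 d f : f != 0 -> strict_transform P d f != 0.
Proof.
move=> /(lowest_neq0 (exc_par d)); apply: contraNneq => E.
by rewrite -strict_slice E rmorph0.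
Qed.

Lemma pullback_neq0 d f : f != 0 -> pullback d f != 0.
Proof.
by move=> f0; rewrite pullback_strict mulf_neq0 ?expf_neq0 ?exc_eq_neq0 ?strict_neq0.
Qed.

Lemma not_near d f : ~~ on_curve f P -> ~~ inf_near P f d.
Proof.
apply: contraNN => near; rewrite /on_curve -(pullback_eval d) pullback_strict mevalM.
by rewrite (eqP near) mul0r.
Qed.

Lemma strict_eval d f :
  (strict_transform P d f).@[exc_point P d 0] = (lowest_at (exc_par d) f).[odflt 0 d].
Proof.
by rewrite -(eval_slice _ _ (exc_var_par d)) exc_point_var strict_slice exc_point_par.
Qed.

(** With multiplicity 0 the lowest form would be the constant f(P) = 0, against [lowest_neq0]. *)
Lemma mult_gt0 f : f != 0 -> on_curve f P -> (0 < mult P f)%N.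
Proof.
move=> f0 fP; rewrite lt0n; apply/eqP => m0; have := lowest_neq0 1 f0.
rewrite [lowest_at 1 f]size1_polyC; last first.
  by apply/leq_sizeP => i i0; apply: coef_lowest_gt; rewrite m0.
have -> : (lowest_at 1 f)`_0 = 0; last by rewrite eqxx.
rewrite -horner_coef0 -[LHS](strict_eval (Some 0) f) -[RHS](eqP fP).
by rewrite -[RHS](pullback_eval (Some 0) f) pullback_strict m0 mulr1.
Qed.

(** * Local numbers along the exceptional line *)

Section Sum.
Variable W : 'rV[k]_2 -> {mpoly k[2]} -> {mpoly k[2]} -> enat.
Hypothesis locW : forall Q, local_number Q (W Q).

Lemma big_enat (T : Type) (r : seq T) (F : T -> nat) :
  \big[eadd/Some 0%N]_(d <- r) Some (F d) = Some (\sum_(d <- r) F d)%N.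
Proof. by symmetry; apply: (big_morph Some). Qed.

Lemma sum_count_undup (T : eqType) (r : seq T) :
  (\sum_(a <- undup r) count_mem a r = size r)%N.
Proof.
rewrite -sum1_size -[RHS]big_undup_iterop_count; apply: eq_bigr => a _.
by rewrite Monoid.iteropE; elim: (count_mem a r) => //= n {1}->.
Qed.

Lemma iter_eadd (n m : nat) : iter n (eadd (Some m)) (Some 0%N) = Some (m * n)%N.
Proof. by elim: n => [|n IH]; rewrite ?muln0 //= IH mulnS. Qed.

Lemma exc_local_off d f g : f != 0 -> g != 0 -> ~~ inf_near P f d ->
  W (exc_point P d) (strict_transform P d f) g = Some 0%N.
Proof. by move=> f0 g0 nr; rewrite (local_unit (locW _)) ?strict_neq0. Qed.

Lemma exc_local d f : f != 0 ->
  W (exc_point P d) (strict_transform P d f) (exc_eq d) =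
  W (exc_point P d) (embed (exc_par d) (lowest_at (exc_par d) f)) (exc_eq d).
Proof.
move=> f0; rewrite /exc_eq -exc_point_var.
rewrite (local_slice (locW _) (exc_var_par d)) exc_point_var strict_slice //.
exact: lowest_neq0.
Qed.

Lemma exc_local_affine z f (r : seq k) (c : k) : f != 0 -> c != 0 ->
  lowest_at 1 f = c *: \prod_(a <- r) ('X - a%:P) ->
  W (exc_point P (Some z)) (strict_transform P (Some z) f) (exc_eq (Some z)) =
  Some (count_mem z r).
Proof.
move=> f0 c0 E; rewrite exc_local // E /exc_eq -exc_point_var.
by rewrite (local_embed (locW _) r (exc_var_par _) c0) exc_point_par.
Qed.

Lemma size_lowest j f : (size (lowest_at j f) <= (mult P f).+1)%N.
Proof. by apply/leq_sizeP => i lt; apply: coef_lowest_gt. Qed.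

(* The defect of the degree of the lowest form at (1 : z) is its order of
   vanishing at the point (0 : 1). *)
Lemma lowest_infty f : f != 0 ->
  exists2 s : {poly k}, s.[0] != 0 &
    lowest_at 0 f = 'X^((mult P f).+1 - size (lowest_at 1 f)) * s.
Proof.
move=> f0; have q0 := lowest_neq0 1 f0; have szq := size_lowest 1 f.
have szq_gt0 : (0 < size (lowest_at 1%R f))%N by rewrite size_poly_gt0.
(* Reversal puts the leading coefficient of [lowest_at 1 f] in degree 0. *)
exists (Poly (rev (lowest_at 1 f))).
  by rewrite horner_coef0 coef_Poly nth_rev // subn1 -lead_coefE lead_coef_eq0.
apply/polyP => i; rewrite coefXnM coef_Poly.
set sz := size (lowest_at 1 f) in szq szq_gt0 *; set M := mult P f in szq *.
case: (leqP i M) => [le|lt]; last first.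
  have le : (sz <= i - (M.+1 - sz))%N by lia.
  rewrite coef_lowest_gt // ifF; last by lia.
  by rewrite nth_default // size_rev.
rewrite lowest_rev // -/M; case: ltnP => lt.
  by rewrite nth_default // -/sz; lia.
have lt' : (i - (M.+1 - sz) < sz)%N by lia.
by rewrite nth_rev // -/sz; congr (_`__); lia.
Qed.

(** The factor s of [lowest_infty] is a unit at (0 : 1), and each factor X contributes 1. As [size]
    exceeds the degree by one, the value is m minus the degree of [lowest_at 1 f]. *)
Lemma exc_local_infty f : f != 0 ->
  W (exc_point P None) (strict_transform P None f) (exc_eq None) =
  Some ((mult P f).+1 - size (lowest_at 1%R f))%N.
Proof.
move=> f0; have [s s0 E] := lowest_infty f0; rewrite exc_local // -[exc_par None]/0 E.
have := exc_point_par None; have := exc_point_var None; rewrite /exc_eq.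
move: (exc_point P None) => Q /= <- Q0; have loc := locW Q.
have sn0 : s != 0 by apply: contraNneq s0 => ->; rewrite horner0.
have ij : (1 : 'I_2) != 0 by [].
have X1n0 := mvar_neq0 1 (Q 0 1).
rewrite rmorphM (local_mul loc) ?embed_eq0 ?expf_neq0 ?polyX_eq0 //.
rewrite [X in eadd _ X](local_unit loc) ?embed_eq0 //; last first.
  by rewrite /on_curve -(eval_slice _ _ ij) slice_embed // Q0.
rewrite rmorphXn /= (local_exp loc) ?embed_eq0 ?polyX_eq0 //.
have -> : 'X = 'X - (Q 0 0)%:P :> {poly k} by rewrite Q0 subr0.
by rewrite (local_embed_lin loc) // eqxx iter_eadd mul1n eaddC.
Qed.

(** The points (1 : z) contribute the roots of [lowest_at 1 f] with multiplicity, in total its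
    degree; (0 : 1) contributes what is missing to m. *)
Lemma exc_local_sum f : f != 0 ->
  \big[eadd/Some 0%N]_(d \in [set d | inf_near P f d]%classic)
    W (exc_point P d) (strict_transform P d f) (exc_eq d) = Some (mult P f).
Proof.
move=> f0; have q0 := lowest_neq0 1 f0.
have [r rE] := closed_field_poly_normal (lowest_at 1 f).
have c0 : lead_coef (lowest_at 1 f) != 0 by rewrite lead_coef_eq0.
pose F d := W (exc_point P d) (strict_transform P d f) (exc_eq d).
have F_off d : ~~ inf_near P f d -> F d = Some 0%N.
  by move=> nd; apply: exc_local_off; rewrite ?exc_eq_neq0.
have F_infty : F None = Some ((mult P f).+1 - size (lowest_at 1%R f))%N.
  exact: exc_local_infty.
have F_affine z : F (Some z) = Some (count_mem z r) := exc_local_affine z f0 c0 rE.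
rewrite -[LHS]/(\big[eadd/Some 0%N]_(d \in [set d | inf_near P f d]%classic) F d).
move: F F_off F_infty F_affine => F F_off F_infty F_affine.
(* Terms off the strict transform are 0, so the sum may run over the whole exceptional line; its
   support lies in (0 : 1) and the distinct roots. *)
rewrite (@fsbig_widen _ _ _ _ _ setT) //; last by move=> d [_ /negP /F_off].
rewrite (@fsbigE _ _ _ _ _ (None :: map Some (undup r))) //; first last.
- case=> [z _|_]; last by rewrite in_cons eqxx.
  rewrite in_cons /= (mem_map (@Some_inj _)) mem_undup => /count_memPn z0.
  by rewrite F_affine z0.
- rewrite cons_uniq (map_inj_uniq (@Some_inj _)) undup_uniq andbT.
  by apply/mapP => -[].
rewrite (eq_bigl xpredT); last by move=> d; rewrite in_setT.
rewrite big_cons big_map F_infty (eq_bigr _ (fun z _ => F_affine z)).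
rewrite big_enat sum_count_undup /=; congr Some.
have sz : size (lowest_at 1 f) = (size r).+1.
  by rewrite rE size_scale // size_prod_XsubC.
by have := size_lowest 1 f; rewrite sz subSS => ?; rewrite subnK.
Qed.

(** One step of the recursion for [B_number], with W at the infinitely near points. *)
Definition noether_number f g : enat :=
  eadd (Some (mult P f * mult P g)%N)
    (\big[eadd/Some 0%N]_(d \in [set d | inf_near P f d && inf_near P g d]%classic)
       W (exc_point P d) (strict_transform P d f) (strict_transform P d g)).

(** The exceptional factors of the total transform of g contribute m(g) times the sum in
    [exc_local_sum], that is m(f) m(g). Points off the strict transform of g add 0, so the index set
    may depend on f alone. *)
Lemma noether_total f g : f != 0 -> g != 0 ->
  noether_number f g =
  \big[eadd/Some 0%N]_(d \in [set d | inf_near P f d]%classic)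
    W (exc_point P d) (strict_transform P d f) (pullback d g).
Proof.
move=> f0 g0; have fin := exc_finite P f0.
pose A d := W (exc_point P d) (strict_transform P d f) (exc_eq d).
pose B d := W (exc_point P d) (strict_transform P d f) (strict_transform P d g).
have W_total d : W (exc_point P d) (strict_transform P d f) (pullback d g) =
    eadd (iter (mult P g) (eadd (A d)) (Some 0%N)) (B d).
  rewrite pullback_strict; apply: (local_mulr_exp (locW _)).
  - exact: strict_neq0.
  - exact: strict_neq0.
  - exact: exc_eq_neq0.
have A_sum : \big[eadd/Some 0%N]_(d \in [set d | inf_near P f d]%classic) A d =
    Some (mult P f).
  exact: exc_local_sum.
have B_off d : ~~ inf_near P g d -> B d = Some 0%N.
  move=> gd; have f'0 := strict_neq0 d f0; have g'0 := strict_neq0 d g0.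
  by rewrite /B (local_sym (locW _) f'0 g'0) (local_unit (locW _) g'0 f'0).
under [RHS]eq_fsbigr => d _ do rewrite W_total.
rewrite /noether_number -[X in eadd _ X = _]/(\big[eadd/Some 0%N]_(d \in
  [set d | inf_near P f d && inf_near P g d]%classic) B d).
move: A B {W_total} A_sum B_off => A B A_sum B_off.
rewrite [RHS]fsbig_finite // big_split; apply: (congr2 eadd).
  rewrite -iter_eadd -A_sum fsbig_finite //.
  elim: (mult P g) => [|n IH] /=; first by rewrite big1.
  by rewrite big_split -IH.
by rewrite -fsbig_finite //; exact: fsbig_andr.
Qed.

Lemma noether_sym f g : f != 0 -> g != 0 -> noether_number f g = noether_number g f.
Proof.
move=> f0 g0; rewrite /noether_number mulnC; apply: (congr2 eadd) => //.
apply: eq_fsbig_andC => d.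
exact: (local_sym (locW _) (strict_neq0 d f0) (strict_neq0 d g0)).
Qed.

Lemma expand_mvar i : expand P ('X_i - (P 0 i)%:MP) = 'X_i.
Proof.
rewrite /expand raddfB /= comp_mpolyC comp_mpolyXU -tnth_nth tnth_mktuple.
by rewrite addrK.
Qed.

Lemma mult_mvar i : mult P ('X_i - (P 0 i)%:MP) = 1%N.
Proof.
by rewrite /mult expand_mvar msuppX big_cons big_nil mdeg1 (minn_idPl _) // msizeX mdeg1.
Qed.

Lemma noether_local : local_number P noether_number.
Proof.
split=> [f g f0 g0 fP|f g|f1 f2 g f10 f20 g0|f g h f0 g0 gh0|].
- rewrite noether_total // fsbig1 // => d /= near.
  by have := not_near d fP; rewrite near.
- exact: noether_sym.
(* Symmetry moves the product to the argument that enters by its total transform. *)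
- rewrite -!(noether_sym g0) ?mulf_neq0 // !noether_total ?mulf_neq0 //.
  apply: (eq_fsbig_split (exc_finite P g0)) => d; rewrite pullbackM.
  apply: (local_mulr (locW _) (strict_neq0 d g0)).
    exact: pullback_neq0.
  exact: pullback_neq0.
- rewrite !noether_total //; apply: eq_fsbigr => d _.
  (* The total transform of h f is a multiple of the strict transform of f. *)
  have E : pullback d (g + h * f) =
      pullback d g + pullback d h * exc_eq d ^+ mult P f * strict_transform P d f.
    by rewrite mulrAC -mulrA -pullback_strict -pullbackM /pullback rmorphD.
  rewrite E; apply: (local_add (locW _)) (strict_neq0 d f0) (pullback_neq0 d g0) _.
  by rewrite -E; exact: pullback_neq0.
rewrite noether_total ?mvar_neq0 //.
(* The strict transform of x = p1 misses the first chart, so only (0 : 1) counts; there y - p2 pulls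
   back to the exceptional equation, and two coordinate lines remain. *)
have strictE d :
    strict_transform P d ('X_0 - (P 0 0)%:MP) = if d is Some _ then 1 else 'X_0.
  apply: (mulIf (exc_eq_neq0 d)); have := pullback_strict d ('X_0 - (P 0 0)%:MP).
  rewrite mult_mvar expr1 => <-; rewrite /pullback raddfB /= comp_mpolyC comp_mpolyXU.
  by case: d => [z|] /=; rewrite ?mul1r // addrAC subrr add0r mulrC.
rewrite (_ : [set d | _]%classic = [set None]%classic); last first.
  rewrite predeqE => -[z|] /=; rewrite /inf_near /on_curve strictE; split=> //.
    by rewrite meval1 oner_eq0.
  by move=> _; rewrite mevalXU (exc_point_par None).
rewrite fsbig_set1 strictE.
have -> : pullback None ('X_1 - (P 0 1)%:MP) = 'X_1 - (exc_point P None 0 1)%:MP.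
  by rewrite /pullback raddfB /= comp_mpolyC comp_mpolyXU (exc_point_var None).
have -> : 'X_0 = 'X_0 - (exc_point P None 0 0)%:MP :> {mpoly k[2]}.
  by rewrite (exc_point_par None) mpolyC0 subr0.
exact: local_one (locW _).
Qed.

End Sum.

End Blowup.

(** * Comparison *)

Section FultonNumber.
Variable k : closedFieldType.
Implicit Types (f g h : {mpoly k[2]}) (P : 'rV[k]_2).

Lemma constantP f : ~~ nonconstant f -> exists c, f = c%:MP.
Proof. by rewrite -leqNgt => /msize1_polyC E; eexists; exact: E. Qed.

Lemma nonconstant_neq0 f : nonconstant f -> f != 0.
Proof. by apply: contraTneq => ->; rewrite /nonconstant msize0. Qed.

Lemma on_curve_nonconstant f P : f != 0 -> on_curve f P -> nonconstant f.
Proof.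
move=> f0 fP; apply: contraT => /constantP[c fE].
by move: f0 fP; rewrite fE /on_curve mevalC mpolyC_eq0 => /negP.
Qed.

Lemma nonconstantM f g : f != 0 -> g != 0 ->
  nonconstant (f * g) = nonconstant f || nonconstant g.
Proof.
move=> f0 g0; rewrite /nonconstant msizeM //.
move: f0 g0; rewrite -!msize_poly_eq0; move: (msize f) (msize g).
by move=> [|[|a]] [|[|b]] //= _ _; rewrite ?addnS ?addn0.
Qed.

Variable I : 'rV[k]_2 -> {mpoly k[2]} -> {mpoly k[2]} -> enat.
Hypothesis fultonI : fulton_number I.

(* Strict transforms of curves may be constant, where I is unconstrained. *)
Definition fulton_ext P f g : enat :=
  if nonconstant f && nonconstant g then I P f g else Some 0%N.

Lemma fulton_extE P f g : nonconstant f -> nonconstant g -> fulton_ext P f g = I P f g.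
Proof. by rewrite /fulton_ext => -> ->. Qed.

Lemma no_common_tangent_axes P :
  ~ common_tangent P ('X_0 - (P 0 0)%:MP) ('X_1 - (P 0 1)%:MP).
Proof.
have lowest i : lowest_form P ('X_i - (P 0 i)%:MP) = 'X_i.
  by rewrite /lowest_form mult_mvar expand_mvar pihomogX /= mdeg1 eqxx.
case=> a [b [[ab0 [q]]]]; rewrite lowest => E0 [_ [q']]; rewrite lowest => E1.
(* The direction of the line a x + b y = 0, on which both x and y would have to vanish. *)
pose v (i : 'I_2) := if i == 0 then b else - a.
have l0 : (a *: 'X_0 + b *: 'X_1).@[v] = 0.
  by rewrite mevalD !mevalZ !mevalXU /v /= mulrN mulrC subrr.
have := congr1 (meval v) E0; rewrite mevalM l0 mulr0 mevalXU /v /= => b0.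
have := congr1 (meval v) E1; rewrite mevalM l0 mulr0 mevalXU /v /= => /eqP.
by rewrite oppr_eq0 => /eqP a0; rewrite a0 b0 eqxx in ab0.
Qed.

Lemma fulton_local P : local_number P (fulton_ext P).
Proof.
split=> [f g f0 g0 fP|f g f0 g0|f1 f2 g f10 f20 g0|f g h f0 g0 gh0|].
- rewrite /fulton_ext; case: ifP => // /andP[nf ng].
  by apply/(fulton_eq0 fultonI) => //; left.
- by rewrite /fulton_ext andbC; case: ifP => // /andP[ng nf]; apply: (fulton_sym fultonI).
- rewrite /fulton_ext nonconstantM //.
  have [ng|_] := boolP (nonconstant g); last by rewrite !andbF.
  rewrite !andbT; have [nf1|/constantP[c1 f1E]] := boolP (nonconstant f1);
    have [nf2|/constantP[c2 f2E]] := boolP (nonconstant f2) => /=.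
  + exact: (fulton_mul fultonI).
  + rewrite f2E mpolyC_eq0 in f20; rewrite f2E mulrC mul_mpolyC (fulton_scale fultonI) //.
    by case: (I P f1 g) => //= a; rewrite addn0.
  + rewrite f1E mpolyC_eq0 in f10; rewrite f1E mul_mpolyC (fulton_scale fultonI) //.
    by case: (I P f2 g).
  + by [].
- rewrite /fulton_ext; have [nf|_ //] := boolP (nonconstant f).
  (* At a point of f, g and g + h f take the same value. If exactly one of them is constant, either
     P is off f or the other one misses P, and both numbers are 0. *)
  have fgP : on_curve f P -> (g + h * f).@[P 0] = g.@[P 0].
    by move=> /eqP fP; rewrite mevalD mevalM fP mulr0 addr0.
  have offC c u : u = c%:MP -> u != 0 -> u.@[P 0] != 0.
    by move=> ->; rewrite mpolyC_eq0 mevalC.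
  have [ng|/constantP[c gE]] := boolP (nonconstant g);
    have [ngh|/constantP[c' ghE]] := boolP (nonconstant (g + h * f)) => //=.
  + exact: (fulton_add fultonI).
  + apply/(fulton_eq0 fultonI) => //; have [fP|] := boolP (on_curve f P); last by left.
    by right; rewrite /on_curve -fgP //; apply: offC ghE gh0.
  + apply/esym/(fulton_eq0 fultonI) => //.
    have [fP|] := boolP (on_curve f P); last by left.
    by right; rewrite /on_curve fgP //; apply: offC gE g0.
have nX i : nonconstant ('X_i - (P 0 i)%:MP).
  by apply: on_curve_nonconstant (mvar_neq0 _ _) (mvar_on P i).
rewrite fulton_extE //; have := fulton_eq_mult fultonI P (nX 0) (nX 1).
by rewrite !mult_mvar => -[_]; apply; exact: no_common_tangent_axes.
Qed.

(** Uniqueness is applied with I as the first function: its axioms supply the positivity and the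
    infinite values that the algorithm uses. *)
Lemma fulton_noether P f g n : nonconstant f -> nonconstant g ->
  I P f g = Some n -> noether_number P fulton_ext f g = Some n.
Proof.
move=> nf ng In; apply: (local_number_unique (fulton_local P))
  (nonconstant_neq0 nf) (nonconstant_neq0 ng) _.
- exact: noether_local fulton_local.
- move=> u v u0 v0 uP vP; have nu := on_curve_nonconstant u0 uP.
  have nv := on_curve_nonconstant v0 vP; rewrite fulton_extE //.
  by move=> /(fulton_eq0 fultonI P nu nv)[]/negP.
- move=> u h u0 h0 uP; have nu := on_curve_nonconstant u0 uP.
  have nhu : nonconstant (h * u) by rewrite nonconstantM // nu orbT.
  rewrite fulton_extE //; apply: (fulton_infinite fultonI) => //.
  by exists u; split=> //; [exists 1; rewrite mul1r|exists h].
by rewrite fulton_extE.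
Qed.

Lemma eadd_seq_Some (T : eqType) (r : seq T) (F : T -> enat) n :
  \big[eadd/Some 0%N]_(x <- r) F x = Some n ->
  forall x, x \in r -> exists2 m, F x = Some m & (m <= n)%N.
Proof.
elim: r n => // y r IH n; rewrite big_cons.
case Fy: (F y) => [a|] //; case E: (\big[_/_]_(_ <- _) _) => [b|] //= [<-] x.
rewrite in_cons => /predU1P[->|/(IH _ E)[m Fx le]]; first by exists a; rewrite ?leq_addr.
by exists m => //; rewrite (leq_trans le) ?leq_addl.
Qed.

Lemma B_number_finite n P f g : nonconstant f -> nonconstant g ->
  I P f g = Some n -> B_number P f g = Some n.
Proof.
elim/ltn_ind: n P f g => n IHn P f g nf ng In.
have f0 := nonconstant_neq0 nf; have g0 := nonconstant_neq0 ng.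
rewrite B_rec; case: asboolP => [/(fulton_infinite fultonI nf ng)|nsh]; first by rewrite In.
case: ifP => [|/negbFE/andP[fP gP]].
  by rewrite negb_and => /orP /(fulton_eq0 fultonI P nf ng) <-.
have := fulton_noether nf ng In; rewrite /noether_number.
rewrite !fsbig_finite; try exact: near_finite.
case S: (\big[_/_]_(_ <- _) fulton_ext _ _ _) => [s|] //= [nE].
suff -> : \big[eadd/Some 0%N]_(d <- finmap.enum_fset
    (fset_set [set d | inf_near P f d && inf_near P g d]%classic))
    B_number (exc_point P d) (strict_transform P d f) (strict_transform P d g) = Some s.
  by rewrite nE.
rewrite -S; apply: eq_big_seq => d dr.
have [m Em le_ms] := eadd_seq_Some S dr; rewrite Em.
move: dr; rewrite in_fset_set; last exact: near_finite.
rewrite inE /= => /andP[fd gd].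
(* A strict transform passing through the point is non-constant, so [fulton_ext] is I there. *)
have nf' := on_curve_nonconstant (strict_neq0 P d f0) fd.
have ng' := on_curve_nonconstant (strict_neq0 P d g0) gd.
apply: IHn => //; last by rewrite -fulton_extE.
(* Both multiplicities are positive, so m <= s < n. *)
by rewrite -nE (leq_ltn_trans le_ms) // -[X in (X < _)%N]add0n ltn_add2r muln_gt0 !mult_gt0.
Qed.

End FultonNumber.

Theorem theorem3p9 (k : closedFieldType) (char0 : [pchar k] =i pred0)
    (I : 'rV[k]_2 -> {mpoly k[2]} -> {mpoly k[2]} -> enat)
    (fultonI : fulton_number I)
    (f g : {mpoly k[2]}) (ncf : nonconstant f) (ncg : nonconstant g)
    (P : 'rV[k]_2) :
  B_number P f g = I P f g.
Proof.
have [sh|nsh] := pselect (share_component P f g).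
  by rewrite B_rec (fulton_infinite fultonI) //; case: asboolP.
have [n In] := fulton_finite fultonI ncf ncg nsh.
by rewrite In; exact: (B_number_finite fultonI).
Qed.
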